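(* Let $k,r$ be rational numbers with $r\neq0$, let $\varepsilon\in\{1,-1\}$, put $t=rk^{10}$ and $$m=\frac{k}{r}(t-11\varepsilon).$$ Then the following two tuples $(s_0,\dots,s_{10})$ are mutually conjugate solutions of $|F(11,m)|=1$: (1) $s_0=1,\ s_1=-\varepsilon rk^9,\ s_2=5\varepsilon rk^8,\ s_3=-15\varepsilon rk^7,\ s_4=30\varepsilon rk^6,\ s_5=-42\varepsilon rk^5,\ s_6=42\varepsilon rk^4,\ s_7=-30\varepsilon rk^3,\ s_8=15\varepsilon rk^2,\ s_9=-5\varepsilon rk,\ s_{10}=\varepsilon r$; (2) $$\begin{aligned} s_0&=t^{10}-55\varepsilon t^9+1265t^8-15730\varepsilon t^7+114037t^6-483637\varepsilon t^5+1137015t^4-1295910\varepsilon t^3+527329t^2-32065\varepsilon t+1,\\ s_1&=rk^9(t^9-54\varepsilon t^8+1216t^7-14749\varepsilon t^6+103758t^5-423776\varepsilon t^4+947934t^3-1005966\varepsilon t^2+363493t-16796\varepsilon),\\ s_2&=rk^8(t^9-53\varepsilon t^8+1168t^7-13811\varepsilon t^6+94212t^5-370171\varepsilon t^4+786526t^3-774787\varepsilon t^2+246779t-8398\varepsilon),\\ s_3&=rk^7(t^9-52\varepsilon t^8+1121t^7-12915\varepsilon t^6+85362t^5-322301\varepsilon t^4+649346t^3-591812\varepsilon t^2+164814t-3978\varepsilon),\\ s_4&=rk^6(t^9-51\varepsilon t^8+1075t^7-12060\varepsilon t^6+77172t^5-279676\varepsilon t^4+533294t^3-448110\varepsilon t^2+108134t-1768\varepsilon),\\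 s_5&=rk^5(t^9-50\varepsilon t^8+1030t^7-11245\varepsilon t^6+69607t^5-241836\varepsilon t^4+435590t^3-336175\varepsilon t^2+69589t-728\varepsilon),\\ s_6&=rk^4(t^9-49\varepsilon t^8+986t^7-10469\varepsilon t^6+62633t^5-208350\varepsilon t^4+353750t^3-249740\varepsilon t^2+43849t-273\varepsilon),\\ s_7&=rk^3(t^9-48\varepsilon t^8+943t^7-9731\varepsilon t^6+56217t^5-178815\varepsilon t^4+285563t^3-183609\varepsilon t^2+26998t-91\varepsilon),\\ s_8&=rk^2(t^9-47\varepsilon t^8+901t^7-9030\varepsilon t^6+50327t^5-152855\varepsilon t^4+229069t^3-133506\varepsilon t^2+16204t-26\varepsilon),\\ s_9&=rk(t^9-46\varepsilon t^8+860t^7-8365\varepsilon t^6+44932t^5-130120\varepsilon t^4+182538t^3-95940\varepsilon t^2+9454t-6\varepsilon),\\ s_{10}&=r(t^9-45\varepsilon t^8+820t^7-7735\varepsilon t^6+40002t^5-110285\varepsilon t^4+144450t^3-68085\varepsilon t^2+5344t-\varepsilon). \end{aligned}$$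
   Context: For $N\ge1$ and a tuple $s=(s_0,\dots,s_{N-1})$ let $X(s)$ be the $N\times N$ matrix with (indices $0\le i,j\le N-1$) entry $s_{i-j}$ if $i\ge j$ and $m\,s_{N+i-j}$ if $i<j$; it is the matrix of the form $s_0+s_1\sqrt[N]{m}+\dots+s_{N-1}\sqrt[N]{m^{N-1}}$. The norm is $|F(N,m)|=\det X(s)$. Tuples $s,\overline{s}$ are conjugate if $X(s)X(\overline{s})=|F(N,m)|\cdot E$, with $E$ the identity matrix. Here $N=11$. *)

(* Defs.v *)
From mathcomp Require Import all_boot all_order all_algebra.
Import GRing.Theory.
Local Open Scope ring_scope.

(* The matrix X(s) of the form s_0 + s_1 m^(1/N) + ... + s_(N-1) m^((N-1)/N);
   the truncated differences below are exact, as j <= i in the first branch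
   and j < N in the second. *)
Definition formMx {R : comNzRingType} {N : nat} (m : R) (s : N.-tuple R) :
    'M[R]_N :=
  \matrix_(i < N, j < N)
    if (j <= i)%N then s`_(i - j) else m * s`_(N + i - j).

(* The norm |F(N, m)| of the form: the bars denote a determinant, so no absolute
   value is taken. *)
Definition formNorm {R : comNzRingType} {N : nat} (m : R) (s : N.-tuple R) : R :=
  \det (formMx m s).

(* The norm on the right-hand side is that of s, so the relation is not
   symmetric by definition. *)
Definition conjugate {R : comNzRingType} {N : nat} (m : R)
    (s s' : N.-tuple R) : Prop :=
  formMx m s *m formMx m s' = (formNorm m s)%:M.

(* Main.v *)
Require Import Defs.
From mathcomp Require Import all_boot all_order all_algebra.
From mathcomp Require Import zify ring.
Import GRing.Theory.
Local Open Scope ring_scope.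

(** The matrix X(s) represents multiplication by the element
    s_0 + s_1 theta + ... + s_(N-1) theta^(N-1) of R[theta], theta^N = m, in the
    basis of powers of theta.  Hence X(s) = s(Theta), where Theta represents
    theta itself ([formMxE]), X is multiplicative, and everything takes place in
    a commutative ring.

    The first tuple is an eleventh power up to a scalar.  Its coefficients
    are the numbers C(11, j) / 11 with alternating signs, so that

      s(theta) = 1 + eps r / (11 k) * ((k - theta)^11 - k^11 + m),

    and since k^11 - m = 11 eps k / r, this is c (k - theta)^11 with
    c = eps r / (11 k).  The norm of k - theta is k^11 - m = 1 / c
    ([det_sub_root]), so the norm of s is c^11 (1 / c)^11 = 1
    ([formNorm_binomial]).  For k = 0 the number m vanishes and X(s) is
    unitriangular ([formNorm_unit]).

    The second tuple is the inverse of this unit.  A product X(s) X(s') commutes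
    with Theta, hence is determined by its first column, and s s' = 1 amounts to
    eleven identities between rational functions of k and r
    ([mul_formMx_eq1]).  The norm of s' and the relation in the other order then
    follow from X(s) X(s') = 1. *)

(** * The matrix of the root *)

(** Multiplication by theta sends theta^j to theta^(j+1) for j < n, and theta^n
    to m; for n = 0 the matrix is the scalar m. *)
Definition rootMx {R : comNzRingType} {n : nat} (m : R) : 'M[R]_n.+1 :=
  \matrix_(i, j)
    if j == n :> nat then m *+ (i == 0 :> nat) else (i == j.+1 :> nat)%:R.

Lemma mul_rootMx (R : comNzRingType) (n : nat) (m : R) (A : 'M[R]_n.+1) i j :
  (rootMx m *m A) i j =
    if i == 0 :> nat then m * A ord_max j else A (inord i.-1) j.
Proof.
rewrite mxE; case: ifP => [/eqP i0|in0].
  rewrite (bigD1 ord_max) //= big1 ?addr0 => [|l ln].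
    by rewrite mxE /= eqxx i0 mulr1n.
  have {}ln : (l == n :> nat) = false by apply: negbTE.
  by rewrite mxE ln i0 mul0r.
have ip : (i.-1 < n)%N by have := ltn_ord i; lia.
rewrite (bigD1 (inord i.-1)) //= big1 ?addr0 => [|l li].
  rewrite mxE inordK; last by lia.
  by rewrite ifF ?prednK ?eqxx ?mul1r //; lia.
rewrite mxE in0; case: ifP => _; first by rewrite mulr0n mul0r.
case: eqP => [il|]; last by rewrite mul0r.
by case/eqP: li; apply: val_inj; rewrite /= inordK ?il //=; lia.
Qed.

Lemma mulmx_root (R : comNzRingType) (n : nat) (m : R) (A : 'M[R]_n.+1) i j :
  (A *m rootMx m) i j =
    if j == n :> nat then A i ord0 * m else A i (inord j.+1).
Proof.
rewrite mxE; case: ifP => jn.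
  rewrite (bigD1 ord0) //= big1 ?addr0 => [|l l0]; first by rewrite mxE jn.
  have {}l0 : (l == 0 :> nat) = false by apply: negbTE.
  by rewrite mxE jn l0 mulr0n mulr0.
have jp : (j.+1 < n.+1)%N by have := ltn_ord j; lia.
rewrite (bigD1 (inord j.+1)) //= big1 ?addr0 => [|l lj].
  by rewrite mxE jn inordK // eqxx mulr1.
rewrite mxE jn; case: eqP => [jl|]; last by rewrite mulr0.
by case/eqP: lj; apply: val_inj; rewrite /= inordK.
Qed.

Lemma formMx_comm_root (R : comNzRingType) (n : nat) (m : R)
    (s : n.+1.-tuple R) : GRing.comm (rootMx m) (formMx m s).
Proof.
apply/matrixP => i j; rewrite [LHS]mul_rootMx [RHS]mulmx_root !mxE /=.
have [li lj] := (ltn_ord i, ltn_ord j).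
case: (eqVneq (i : nat) 0%N) => [i0|in0]; case: (eqVneq (j : nat) n) => [jn|jn].
- by rewrite i0 jn leqnn subnn mulrC.
- rewrite inordK; last by lia.
  rewrite ifT; last by lia.
  by rewrite ifF ?i0; [congr (_ * s`_ _); lia|lia].
- rewrite inordK; last by lia.
  rewrite ifF; last by lia.
  by rewrite mulrC; congr (s`_ _ * _); lia.
- rewrite !inordK; try lia.
  have -> : (j <= i.-1)%N = (j < i)%N by lia.
  case: ifP => _; first by congr (s`_ _); lia.
  by congr (_ * s`_ _); lia.
Qed.

(** The basis vector e_(j+1) is Theta e_j, so the column j+1 of a matrix A that
    commutes with Theta is Theta (A e_j). *)
Lemma comm_root_inj (R : comNzRingType) (n : nat) (m : R) (A B : 'M[R]_n.+1) :
  GRing.comm (rootMx m) A -> GRing.comm (rootMx m) B ->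
  (forall i, A i ord0 = B i ord0) -> A = B.
Proof.
move=> cA cB AB0; apply/matrixP => i j.
case: j => j; elim: j i => [|j IH] i lt_j.
  by have -> : Ordinal lt_j = ord0 by apply: val_inj.
have lt_j' : (j < n.+1)%N by lia.
have step (C : 'M[R]_n.+1) : C i (Ordinal lt_j) =
    (C *m rootMx m) i (Ordinal lt_j').
  rewrite mulmx_root /= ifF; last by lia.
  by congr (C i _); apply: val_inj; rewrite /= inordK.
have [/esym eA /esym eB] := (cA, cB).
rewrite (step A) (step B) [A *m _]eA [B *m _]eB !mul_rootMx.
by case: ifP => _; rewrite IH.
Qed.

Lemma expr_root_col0 (R : comNzRingType) (n : nat) (m : R) (l : nat) i :
  (l <= n)%N -> (rootMx m ^+ l : 'M[R]_n.+1) i ord0 = (i == l :> nat)%:R.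
Proof.
elim: l i => [|l IH] i ln; first by rewrite expr0 mxE.
have := ltn_ord i => li.
rewrite exprS [LHS]mul_rootMx !IH /=; try lia.
rewrite inordK; last by lia.
case: ifP => i0.
  have -> : (n == l) = false by lia.
  by rewrite mulr0 (eqP i0).
by congr (nat_of_bool _)%:R; lia.
Qed.

(** Both sides commute with Theta, and both have first column s. *)
Lemma formMxE (R : comNzRingType) (n : nat) (m : R) (s : n.+1.-tuple R) :
  formMx m s = horner_mx (rootMx m) (\poly_(i < n.+1) s`_i).
Proof.
apply: (@comm_root_inj _ _ m); first exact: formMx_comm_root.
  exact: (comm_mx_horner _ (commr_refl _)).
move=> i; rewrite [LHS]mxE /= subn0 poly_def rmorph_sum /= summxE.
rewrite (bigD1 i) //= big1 => [|j ji].
  by rewrite addr0 horner_mxZ rmorphXn /= horner_mx_X mxE expr_root_col0 ?eqxx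
    ?mulr1 // -ltnS.
rewrite horner_mxZ rmorphXn /= horner_mx_X mxE expr_root_col0 -1?ltnS //.
have /negbTE-> : i != j :> nat by rewrite eq_sym.
by rewrite mulr0.
Qed.

(** Theta is the transpose of the companion matrix of X^N - m. *)
Lemma char_poly_root (R : comNzRingType) (n : nat) (m : R) :
  char_poly (rootMx m : 'M[R]_n.+1) = 'X^(n.+1) - m%:P.
Proof.
(* The companion matrix has dimension (size p).-1, which equals n.+1 only up to
   rewriting; comparing entries as functions of naturals avoids a cast. *)
have eq_char d (A : 'M[R]_d) (B : 'M[R]_n.+1) : d = n.+1 ->
    (forall (i j : 'I_d) (i' j' : 'I_n.+1), i = i' :> nat -> j = j' :> nat ->
      A i j = B j' i') -> char_poly A = char_poly B.
  move=> dn; rewrite dn in A * => AB.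
  have -> : A = B^T by apply/matrixP => i j; rewrite mxE; exact: AB.
  rewrite /char_poly -[RHS]det_tr; congr (\det _).
  by apply/matrixP => i j; rewrite !mxE eq_sym.
have szP : size ('X^(n.+1) - m%:P) = n.+2.
  by rewrite size_polyDl size_polyXn // size_polyN size_polyC; case: (_ == _).
have monP : 'X^(n.+1) - m%:P \is monic by rewrite monicXnsubC.
rewrite -[RHS](companionmxK monP); apply/esym/eq_char; first by rewrite szP.
move=> i j i' j' ii jj; rewrite !mxE.
have -> : (size ('X^(n.+1) - m%:P)).-2 = n by rewrite szP.
rewrite -ii -jj.
case: ifP => _; last by rewrite eq_sym.
rewrite coefB coefXn coefC opprB.
have -> : (j == n.+1 :> nat) = false by rewrite jj; have := ltn_ord j'; lia.
by rewrite subr0; case: eqP.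
Qed.

Lemma horner_char_poly (R : comNzRingType) (n : nat) (A : 'M[R]_n) (a : R) :
  (char_poly A).[a] = \det (a%:M - A).
Proof.
rewrite -horner_evalE -det_map_mx; congr (\det _).
apply/matrixP => i j; rewrite !mxE /= /horner_eval.
by rewrite hornerD hornerN hornerMn hornerX hornerC.
Qed.

(** * Units and their inverses *)

(** The norm of a - theta. *)
Lemma det_sub_root (R : comNzRingType) (n : nat) (m a : R) :
  \det (a%:M - rootMx m : 'M[R]_n.+1) = a ^+ n.+1 - m.
Proof.
by rewrite -horner_char_poly char_poly_root hornerD hornerN hornerC hornerXn.
Qed.

(** The hypothesis says that the first column of the product, X(s) applied to
    the vector s', is that of the identity. *)
Lemma mul_formMx_eq1 (R : comNzRingType) (n : nat) (m : R)
    (s s' : n.+1.-tuple R) :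
  (forall i, \sum_(j < n.+1) formMx m s i j * s'`_j = (i == ord0)%:R) ->
  formMx m s *m formMx m s' = 1%:M.
Proof.
move=> ss'; apply: (@comm_root_inj _ _ m); last 1 first.
- move=> i; rewrite !mxE -ss'; apply: eq_bigr => j _.
  by congr (_ * _); rewrite mxE leq0n subn0.
- by apply: commrM; apply: formMx_comm_root.
- exact: commr1.
Qed.

(** The coefficients are those of c (k - theta)^N for N = n.+1 odd: the term
    - theta^N of the expansion equals - m and contributes - c m to s_0.  As
    k - theta has norm k^N - m = 1 / c, the norm is c^N (1 / c)^N. *)
Lemma formNorm_binomial (R : comNzRingType) (n : nat) (k c m : R)
    (s : n.+1.-tuple R) :
  ~~ odd n -> c * (k ^+ n.+1 - m) = 1 ->
  (forall i : 'I_n.+1,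
     s`_i = c * ((-1) ^+ i * k ^+ (n.+1 - i) *+ 'C(n.+1, i))
            - c * m *+ (i == ord0)) ->
  formNorm m s = 1.
Proof.
move=> n_even ckm sE.
(* The correction X^N - m is the characteristic polynomial of Theta. *)
have sP : \poly_(i < n.+1) s`_i =
    c *: ((k%:P - 'X) ^+ n.+1 + ('X^(n.+1) - m%:P)).
  rewrite exprBn big_ord_recr /= subnn expr0 mulr1 binn mulr1n.
  rewrite -signr_odd /= n_even expr1 mulN1r addrA subrK scalerBr scaler_sumr.
  rewrite poly_def !big_ord_recl sE.
  rewrite eqxx scalerBl addrAC; congr (_ + _ - _).
  - rewrite !expr0 !mul1r subn0 bin0 !mulr1n mulr1 -scalerA alg_polyC.
    by rewrite rmorphXn.
  - apply: eq_bigr => i _; rewrite sE mulr0n subr0 -scalerA.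
    congr (_ *: _); rewrite -mul_polyC rmorphMn rmorphM !rmorphXn /= rmorphN1.
    by rewrite mulrnAl.
  - by rewrite expr0 alg_polyC mulr1n polyCM mul_polyC.
rewrite /formNorm formMxE sP horner_mxZ rmorphD /= -char_poly_root.
rewrite Cayley_Hamilton addr0 detZ rmorphXn rmorphB /= horner_mx_C horner_mx_X.
have det_exp l : \det ((k%:M - rootMx m : 'M_n.+1) ^+ l) = (k ^+ n.+1 - m) ^+ l.
  elim: l => [|l IH]; first by rewrite !expr0 det1.
  by rewrite [RHS]exprS [_ ^+ l.+1]exprS -mulmxE det_mulmx IH det_sub_root.
by rewrite det_exp -exprMn ckm expr1n.
Qed.

(** For k != 0 this is c (k - theta)^11 with c = eps r / (11 k).  This c does not
    exist for k = 0, but then m = 0 and X(s) is unitriangular. *)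
Lemma formNorm_unit (k r eps t m : rat) (s : 11.-tuple rat) :
  r != 0 ->
  eps = 1 \/ eps = -1 ->
  t = r * k ^+ 10 ->
  m = k / r * (t - 11%:R * eps) ->
  s = [::
       1;
       - (eps * r * k ^+ 9);
       5%:R * eps * r * k ^+ 8;
       - (15%:R * eps * r * k ^+ 7);
       30%:R * eps * r * k ^+ 6;
       - (42%:R * eps * r * k ^+ 5);
       42%:R * eps * r * k ^+ 4;
       - (30%:R * eps * r * k ^+ 3);
       15%:R * eps * r * k ^+ 2;
       - (5%:R * eps * r * k);
       eps * r] :> seq rat ->
  formNorm m s = 1.
Proof.
move=> r0 eps1 tE mE sE.
have [k0|k0] := eqVneq k 0.
  rewrite /formNorm det_trig; last first.
    apply/is_trig_mxP => i j ij; rewrite mxE leqNgt ij /=.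
    by rewrite mE k0 !mul0r.
  by apply: big1 => i _; rewrite mxE leqnn subnn sE.
have cm : eps * r / (11%:R * k) * (k ^+ 11 - m) = 1.
  by rewrite mE tE; case: eps1 => ->; field; rewrite k0 r0.
apply: (formNorm_binomial _ 10 k _ m s isT cm).
(* Only nth and the binomials are evaluated: 'C(11, i) is replaced by its value,
   so that the remaining goals are field identities. *)
case=> -[|[|[|[|[|[|[|[|[|[|[|//]]]]]]]]]]] lt_i; rewrite /= sE; cbn [nth];
  match goal with |- context [binomial ?a ?b] =>
    let c := eval vm_compute in (binomial a b) in change (binomial a b) with c
  end; rewrite ?subSS ?subn0 ?mulr1n ?mulr0n ?subr0.
- by rewrite expr0 mul1r -mulrBr cm.
all: by field.
Qed.

(* Numerals are cast from nat, where the large ones stay in decimal form: a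
   numeral of ring_scope would be expanded in unary. *)
Theorem mainTheorem8 (k r eps t m : rat) (s s' : 11.-tuple rat) :
  r != 0 ->
  eps = 1 \/ eps = -1 ->
  t = r * k ^+ 10 ->
  m = k / r * (t - 11%:R * eps) ->
  s = [::
       1;
       - (eps * r * k ^+ 9);
       5%:R * eps * r * k ^+ 8;
       - (15%:R * eps * r * k ^+ 7);
       30%:R * eps * r * k ^+ 6;
       - (42%:R * eps * r * k ^+ 5);
       42%:R * eps * r * k ^+ 4;
       - (30%:R * eps * r * k ^+ 3);
       15%:R * eps * r * k ^+ 2;
       - (5%:R * eps * r * k);
       eps * r] :> seq rat ->
  s' = [::
       t ^+ 10 - 55%:R * eps * t ^+ 9 + 1265%:R * t ^+ 8
       - 15730%:R * eps * t ^+ 7 + 114037%:R * t ^+ 6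
       - 483637%:R * eps * t ^+ 5 + 1137015%:R * t ^+ 4
       - 1295910%:R * eps * t ^+ 3 + 527329%:R * t ^+ 2 - 32065%:R * eps * t
       + 1;
       r * k ^+ 9 *
         (t ^+ 9 - 54%:R * eps * t ^+ 8 + 1216%:R * t ^+ 7
          - 14749%:R * eps * t ^+ 6 + 103758%:R * t ^+ 5
          - 423776%:R * eps * t ^+ 4 + 947934%:R * t ^+ 3
          - 1005966%:R * eps * t ^+ 2 + 363493%:R * t - 16796%:R * eps);
       r * k ^+ 8 *
         (t ^+ 9 - 53%:R * eps * t ^+ 8 + 1168%:R * t ^+ 7
          - 13811%:R * eps * t ^+ 6 + 94212%:R * t ^+ 5
          - 370171%:R * eps * t ^+ 4 + 786526%:R * t ^+ 3
          - 774787%:R * eps * t ^+ 2 + 246779%:R * t - 8398%:R * eps);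
       r * k ^+ 7 *
         (t ^+ 9 - 52%:R * eps * t ^+ 8 + 1121%:R * t ^+ 7
          - 12915%:R * eps * t ^+ 6 + 85362%:R * t ^+ 5
          - 322301%:R * eps * t ^+ 4 + 649346%:R * t ^+ 3
          - 591812%:R * eps * t ^+ 2 + 164814%:R * t - 3978%:R * eps);
       r * k ^+ 6 *
         (t ^+ 9 - 51%:R * eps * t ^+ 8 + 1075%:R * t ^+ 7
          - 12060%:R * eps * t ^+ 6 + 77172%:R * t ^+ 5
          - 279676%:R * eps * t ^+ 4 + 533294%:R * t ^+ 3
          - 448110%:R * eps * t ^+ 2 + 108134%:R * t - 1768%:R * eps);
       r * k ^+ 5 *
         (t ^+ 9 - 50%:R * eps * t ^+ 8 + 1030%:R * t ^+ 7
          - 11245%:R * eps * t ^+ 6 + 69607%:R * t ^+ 5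
          - 241836%:R * eps * t ^+ 4 + 435590%:R * t ^+ 3
          - 336175%:R * eps * t ^+ 2 + 69589%:R * t - 728%:R * eps);
       r * k ^+ 4 *
         (t ^+ 9 - 49%:R * eps * t ^+ 8 + 986%:R * t ^+ 7
          - 10469%:R * eps * t ^+ 6 + 62633%:R * t ^+ 5
          - 208350%:R * eps * t ^+ 4 + 353750%:R * t ^+ 3
          - 249740%:R * eps * t ^+ 2 + 43849%:R * t - 273%:R * eps);
       r * k ^+ 3 *
         (t ^+ 9 - 48%:R * eps * t ^+ 8 + 943%:R * t ^+ 7
          - 9731%:R * eps * t ^+ 6 + 56217%:R * t ^+ 5
          - 178815%:R * eps * t ^+ 4 + 285563%:R * t ^+ 3
          - 183609%:R * eps * t ^+ 2 + 26998%:R * t - 91%:R * eps);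
       r * k ^+ 2 *
         (t ^+ 9 - 47%:R * eps * t ^+ 8 + 901%:R * t ^+ 7
          - 9030%:R * eps * t ^+ 6 + 50327%:R * t ^+ 5
          - 152855%:R * eps * t ^+ 4 + 229069%:R * t ^+ 3
          - 133506%:R * eps * t ^+ 2 + 16204%:R * t - 26%:R * eps);
       r * k *
         (t ^+ 9 - 46%:R * eps * t ^+ 8 + 860%:R * t ^+ 7
          - 8365%:R * eps * t ^+ 6 + 44932%:R * t ^+ 5
          - 130120%:R * eps * t ^+ 4 + 182538%:R * t ^+ 3
          - 95940%:R * eps * t ^+ 2 + 9454%:R * t - 6%:R * eps);
       r *
         (t ^+ 9 - 45%:R * eps * t ^+ 8 + 820%:R * t ^+ 7
          - 7735%:R * eps * t ^+ 6 + 40002%:R * t ^+ 5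
          - 110285%:R * eps * t ^+ 4 + 144450%:R * t ^+ 3
          - 68085%:R * eps * t ^+ 2 + 5344%:R * t - eps)] :> seq rat ->
  [/\ formNorm m s = 1, formNorm m s' = 1,
      conjugate m s s' & conjugate m s' s].
Proof.
move=> r0 eps1 tE mE sE s'E.
have norm1 : formNorm m s = 1 by exact: formNorm_unit r0 eps1 tE mE sE.
have ss' : formMx m s *m formMx m s' = 1%:M.
  apply: mul_formMx_eq1 => i; under eq_bigr => j _ do rewrite mxE.
  (* The indices are normalised before s and s' are replaced by their lists: a
     later simplification would expand the large numerals in unary. *)
  case: i => -[|[|[|[|[|[|[|[|[|[|[|//]]]]]]]]]]] lt_i;
    rewrite !big_ord_recl big_ord0 !lift0 /= ?addSn ?add0n ?subSS ?subn0;
    by rewrite sE s'E; cbn [nth]; rewrite ?mE tE; case: eps1 => ->; field.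
have norm1' : formNorm m s' = 1.
  by rewrite -[LHS]mul1r -norm1 -det_mulmx ss' det1.
split=> //; rewrite /conjugate ?norm1 ?norm1' //.
exact: mulmx1C.
Qed.
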